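(* Let $(G,m,w,B)$ be a connected weighted finite graph with boundary, $|B|\ge2$. Suppose that $(G,m,w)$ satisfies the Bakry-Émery curvature-dimension condition $\mathrm{CD}(K,n)$ with $K>0$ and $n>1$. Then the second Steklov eigenvalue satisfies $$\sigma_2\ge\frac{nK}{n-1}.$$
   Context: A weighted graph $(G,m,w)$ consists of a finite, simple, connected graph $G$ with vertex set $V$ and edge set $E$, a positive function $m$ on $V$ (vertex measure, written $m_x$), and a positive function $w$ on $E$ (edge weight), regarded as a symmetric function $w_{xy}$ on $V\times V$ by setting $w_{xy}=0$ when $\{x,y\}\notin E$. Graph with boundary: $(G,m,w,B)$ is a weighted graph together with a nonempty set $B\subset V$ (the boundary) such that no two vertices of $B$ are adjacent and every vertex of $B$ is adjacent to some vertex of $\Omega:=V\setminus B$ (the interior). Laplacian: for $u\in\mathbb{R}^V$, $\Delta u(x)=\frac1{m_x}\sum_{y\in V}(u(y)-u(x))w_{xy}$. Steklov eigenvalues: for $f\in\mathbb{R}^B$ let $u_f\in\mathbb{R}^V$ be the unique function with $u_f=f$ on $B$ and $\Delta u_f=0$ on $\Omega$. The Dirichlet-to-Neumann map $\Lambda:\mathbb{R}^B\to\mathbb{R}^B$ is $\Lambda f(x)=\frac{\partial u_f}{\partial n}(x)$, where $\frac{\partial u}{\partial n}(x)=\frac1{m_x}\sum_{y\in V}(u(x)-u(y))w_{xy}$ for $x\in B$. It is nonnegative and self-adjoint for $\langle f,g\rangle_B=\sum_{x\in B}f(x)g(x)m_x$; its eigenvalues, counted with multiplicity, are $0=\sigma_1<\sigma_2\le\cdots\le\sigma_{|B|}$.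 Bakry-Émery condition: for $f,g\in\mathbb{R}^V$ put $\Gamma(f,g)=\frac12\left(\Delta(fg)-f\Delta g-g\Delta f\right)$ and $\Gamma_2(f,f)=\frac12\Delta\Gamma(f,f)-\Gamma(f,\Delta f)$. Then $(G,m,w)$ satisfies $\mathrm{CD}(K,n)$ if $\Gamma_2(f,f)(x)\ge\frac1n(\Delta f(x))^2+K\,\Gamma(f,f)(x)$ for all $f\in\mathbb{R}^V$ and all $x\in V$. *)

(* Defs.v *)
From mathcomp Require Import all_boot all_order all_algebra.
From mathcomp Require Import polyrcf.
From mathcomp Require Import boolp classical_sets reals.

Set Implicit Arguments.
Unset Strict Implicit.
Unset Printing Implicit Defensive.

Import Order.TTheory GRing.Theory Num.Theory.

Local Open Scope ring_scope.

(* The edge weight is stored as a function on V * V, extended by 0 outside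
   the edge set [wg_adj]. *)
Record weighted_graph (R : realType) (V : finType) := WeightedGraph {
  wg_adj : rel V;
  wg_m : V -> R;
  wg_w : V -> V -> R;
  wg_adj_sym : symmetric wg_adj;
  wg_adj_irr : irreflexive wg_adj;
  wg_connected : forall x y : V, connect wg_adj x y;
  wg_m_gt0 : forall x : V, 0 < wg_m x;
  wg_w_sym : forall x y : V, wg_w x y = wg_w y x;
  wg_w_gt0 : forall x y : V, wg_adj x y -> 0 < wg_w x y;
  wg_w_eq0 : forall x y : V, ~~ wg_adj x y -> wg_w x y = 0
}.

Record is_boundary (R : realType) (V : finType) (G : weighted_graph R V)
    (B : {set V}) : Prop := IsBoundary {
  boundary_neq0 : B != finset.set0;
  boundary_indep : forall x y : V, x \in B -> y \in B -> ~~ wg_adj G x y;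
  boundary_adj_interior : forall x : V, x \in B ->
    exists2 y : V, y \notin B & wg_adj G x y
}.

Section Laplacian.
Variables (R : realType) (V : finType) (G : weighted_graph R V).
Implicit Types f g u : V -> R.

Definition laplacian u (x : V) : R :=
  (wg_m G x)^-1 * \sum_(y : V) (u y - u x) * wg_w G x y.

Definition normal_deriv u (x : V) : R :=
  (wg_m G x)^-1 * \sum_(y : V) (u x - u y) * wg_w G x y.

Definition Gamma f g (x : V) : R :=
  2^-1 * (laplacian (fun y => f y * g y) x
          - f x * laplacian g x - g x * laplacian f x).

Definition Gamma2 f (x : V) : R :=
  2^-1 * laplacian (Gamma f f) x - Gamma f (laplacian f) x.

Definition bakry_emery_CD (K n : R) : Prop :=
  forall (f : V -> R) (x : V),
    n^-1 * (laplacian f x) ^+ 2 + K * Gamma f f x <= Gamma2 f x.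

End Laplacian.

Section Steklov.
Variables (R : realType) (V : finType) (G : weighted_graph R V) (B : {set V}).

Definition bdry : finType := {x : V | x \in B}.

Definition is_harmonic_ext (f : {ffun bdry -> R}) (u : {ffun V -> R}) : Prop :=
  (forall x : bdry, u (val x) = f x) /\
  (forall x : V, x \notin B -> laplacian G u x = 0).

(* When [is_boundary G B] holds there is exactly one harmonic extension of
   each [f]; the default value 0 is then irrelevant. *)
Definition harmonic_ext (f : {ffun bdry -> R}) : {ffun V -> R} :=
  xget 0 [set u | is_harmonic_ext f u]%classic.

Definition DtN (f : {ffun bdry -> R}) : {ffun bdry -> R} :=
  [ffun x => normal_deriv G (harmonic_ext f) (val x)].

(* Column j holds the image under [DtN] of the indicator of the j-th boundary
   vertex, so this is the matrix of [DtN] acting on column vectors. *)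
Definition DtN_mx : 'M[R]_#|bdry| :=
  \matrix_(i, j) DtN [ffun x => (x == enum_val j)%:R] (enum_val i).

(* The real roots of the characteristic polynomial in increasing order (as
   returned by [rootsR]), each repeated according to its multiplicity. *)
Definition steklov_spectrum : seq R :=
  let p := char_poly DtN_mx in
  flatten [seq nseq (mup a p) a | a <- rootsR p].

(* Numbered from 1. *)
Definition steklov_eigenvalue (k : nat) : R := nth 0 steklov_spectrum k.-1.

End Steklov.

(* Main.v *)
Require Import Defs.
From mathcomp Require Import all_boot all_order all_algebra.
From mathcomp Require Import boolp classical_sets reals.
From mathcomp Require Import complex polyrcf ring lra.

(** Let [u] be the harmonic extension of a Steklov eigenfunction for [a <> 0].
    Then [Delta u] is [- a u] on the boundary and [0] inside, so
    [sum m Gamma(u,u) = a |u|_B^2] and [sum m (Delta u)^2 = a^2 |u|_B^2], where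
    [|u|_B^2] is the sum of [m u^2] over the boundary.  As [Delta] is
    self-adjoint with zero integral, [sum m Gamma2(u,u) = sum m (Delta u)^2],
    and summing CD(K,n) against [m] gives [a^2 >= a^2 / n + K a].
    The second eigenvalue is nonzero because the Dirichlet-to-Neumann matrix is
    self-adjoint, hence diagonalizable with real spectrum, and its kernel
    consists of the constants. *)

Set Implicit Arguments.
Unset Strict Implicit.
Unset Printing Implicit Defensive.

Import Order.TTheory GRing.Theory Num.Theory.
Local Open Scope ring_scope.

(** * Real spectra of self-adjoint matrices and lists of roots *)

Section Spectrum.
Local Open Scope complex_scope.

Lemma char_poly_sim (F : fieldType) n (P A B : 'M[F]_n) :
  P \in unitmx -> P *m A = B *m P -> char_poly A = char_poly B.
Proof.
move=> Pu PA; rewrite /char_poly /char_poly_mx.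
have detP : \det (map_mx polyC P) != 0.
  by rewrite det_map_mx polyC_eq0 -unitfE -unitmxE.
apply: (mulfI detP); rewrite -det_mulmx mulrC -det_mulmx.
by congr (\det _); rewrite mulmxBr mulmxBl -!map_mxM PA scalar_mxC.
Qed.

(** The hypothesis on [A] is self-adjointness for the inner product with weights [d], which makes
    [A] diagonalizable with real spectrum. The rank bound serves later to limit the multiplicity of
    the eigenvalue 0. *)
Lemma selfadjoint_spectrum (F : rcfType) n (A : 'M[F]_n) (d : 'I_n -> F) :
    (forall i, 0 < d i) -> (forall i j, d i * A i j = d j * A j i) ->
  exists2 rs : seq F, char_poly A = \prod_(r <- rs) ('X - r%:P)
    & (\rank A <= count (predC1 0%R) rs)%N.
Proof.
move=> d_gt0 dA.
pose s i := Num.sqrt (d i).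
have s_neq0 i : s i != 0 by rewrite gt_eqF // sqrtr_gt0.
have s2 i : d i = s i * s i by rewrite -expr2 sqr_sqrtr // ltW.
pose P := diag_mx (\row_i s i).
have Pu : P \in unitmx.
  by rewrite unitmxE det_diag unitfE; apply/prodf_neq0 => i _; rewrite mxE.
(* Conjugating by [P] makes the matrix symmetric, so that the spectral theorem
   over [F[i]] applies. *)
pose S := \matrix_(i, j) (s i * A i j / s j).
have PA : P *m A = S *m P.
  apply/matrixP => i j; rewrite mul_diag_mx mul_mx_diag !mxE.
  by rewrite divfK.
have Ssym : S^T = S.
  apply/matrixP => i j; rewrite !mxE.
  by apply/eqP; rewrite eqr_div // mulrAC -s2 [X in _ == X]mulrAC -s2 dA.
set toC := real_complex F; pose SC := map_mx toC S.
have SCh : SC \is hermsymmx.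
  apply: realsym_hermsym.
    by apply/is_hermitianmxP; rewrite expr0 scale1r map_mx_id // map_trmx Ssym.
  by apply/mxOverP => i j; rewrite mxE; apply/complex_realP; exists (S i j).
have [U [sp [Uu SCE] spr]] : exists U : 'M[F[i]]_n, exists2 sp : 'rV[F[i]]_n,
    U \in unitmx /\ SC = invmx U *m diag_mx sp *m U & sp \is a realmx.
  have /orthomx_spectralP E := hermitian_normalmx SCh.
  exists (spectralmx SC); exists (spectral_diag SC).
    by split; [exact: spectral_unit|].
  exact: hermitian_spectral_diag_real.
pose rs := [seq complex.Re (sp 0 i) | i <- enum 'I_n].
have spE i : sp 0 i = (complex.Re (sp 0 i))%:C.
  by rewrite RRe_real // (mxOverP spr).
have chA : map_poly toC (char_poly A) = char_poly (diag_mx sp).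
  rewrite (char_poly_sim Pu PA) map_char_poly.
  by apply: (char_poly_sim Uu); rewrite -/SC SCE !mulmxA mulmxV // mul1mx.
exists rs.
  apply: (map_inj_poly (@complexI F)) => //; rewrite -/toC chA.
  rewrite char_poly_trig ?diag_mx_is_trig // rmorph_prod big_map big_enum /=.
  apply: eq_bigr => i _.
  by rewrite mxE eqxx mulr1n rmorphB /= map_polyX map_polyC /= -spE.
rewrite -(mxrank_map toC A).
have -> : \rank (map_mx toC A) = \rank (diag_mx sp).
  have E : map_mx toC P *m map_mx toC A = SC *m map_mx toC P.
    by rewrite -!map_mxM PA.
  have Pcu : map_mx toC P \in unitmx by rewrite map_unitmx.
  rewrite -(eqmxMfull (map_mx toC A) (_ : row_full (map_mx toC P)));
    last by rewrite row_full_unit.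
  rewrite E mxrankMfree ?row_free_unit // SCE mxrankMfree ?row_free_unit //.
  by rewrite (eqmxMfull (diag_mx sp)) // row_full_unit unitmx_inv.
(* Rank is subadditive, and each nonzero diagonal entry contributes a matrix of rank at most 1. *)
rewrite diag_mx_sum_delta -sum1_count big_map big_enum_cond.
rewrite [X in (_ <= X)%N]big_mkcond /=.
apply: (big_ind2 (fun (M : 'M_n) k => \rank M <= k)%N); rewrite ?mxrank0 //.
  move=> M1 k1 M2 k2 h1 h2.
  exact: leq_trans (mxrank_add _ _) (leq_add h1 h2).
move=> i _; case: eqP => [ri0|_] /=; first by rewrite spE ri0 scale0r mxrank0.
by rewrite (leq_trans (mxrank_scale _ _)) // mxrank_delta.
Qed.

Lemma mup_prod_XsubC (F : fieldType) (a : F) (rs : seq F) :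
  mup a (\prod_(r <- rs) ('X - r%:P)) = count_mem a rs.
Proof.
elim: rs => [|r rs IH]; first by rewrite big_nil mupNroot ?root1.
rewrite big_cons mupM ?polyXsubC_eq0 //; last exact/monic_neq0/monic_prod_XsubC.
rewrite IH /= -['X - _]expr1 mup_XsubCX.
by case: eqVneq.
Qed.

Lemma sorted_flatten_nseq (F : realDomainType) (k : F -> nat) (s : seq F) :
  sorted <%R s -> sorted <=%R (flatten [seq nseq (k a) a | a <- s]).
Proof.
rewrite !(sorted_pairwise le_trans, sorted_pairwise lt_trans).
elim: s => //= a s IH /andP[/allP a_lt /IH s_le].
rewrite pairwise_cat s_le andbT; apply/andP; split.
  apply/allrelP => x y /nseqP[-> _] /flatten_mapP[b b_s /nseqP[-> _]].
  exact/ltW/a_lt.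
by elim: (k a) => //= m ->; rewrite andbT all_nseq lexx orbT.
Qed.

(** [rootsR] lists each root of [p] once and [mup] counts its occurrences in [rs]. This ties the
    definition of [steklov_spectrum] to a factorization of the characteristic polynomial. *)
Lemma perm_flatten_mup_rootsR (F : rcfType) (rs : seq F)
    (p := \prod_(r <- rs) ('X - r%:P)) :
  perm_eq (flatten [seq nseq (mup a p) a | a <- rootsR p]) rs.
Proof.
have p_neq0 : p != 0 by exact/monic_neq0/monic_prod_XsubC.
have mupE a : mup a p = count_mem a rs by exact: mup_prod_XsubC.
under eq_map do rewrite mupE.
apply: perm_trans (perm_count_undup rs); apply/perm_flatten/perm_map.
apply: uniq_perm; rewrite ?uniq_roots ?undup_uniq // => a.
by rewrite -roots_on_rootsR // mem_undup in_itv /= root_prod_XsubC.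
Qed.

End Spectrum.

(** * Dirichlet energy, Green's formula and the integrated curvature condition *)

Section Energy.
Variables (R : realType) (V : finType) (G : weighted_graph R V).
Implicit Types u v : V -> R.

Local Notation m := (wg_m G).
Local Notation w := (wg_w G).
Local Notation Delta := (laplacian G).

(** The division by 2 compensates for counting each edge in both orientations. *)
Definition dirichlet u v : R :=
  (\sum_x \sum_y (u y - u x) * (v y - v x) * w x y) / 2.

Lemma wg_w_ge0 x y : 0 <= w x y.
Proof.
by case: (boolP (wg_adj G x y)) => [/wg_w_gt0/ltW|/(wg_w_eq0 (w := G))->].
Qed.

Lemma measure_laplacian u x : m x * Delta u x = \sum_y (u y - u x) * w x y.
Proof. by rewrite mulVKf // gt_eqF // wg_m_gt0. Qed.

Lemma normal_derivE u x : normal_deriv G u x = - Delta u x.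
Proof.
rewrite /normal_deriv /laplacian -mulrN -sumrN; congr (_ * _).
by apply: eq_bigr => y _; rewrite -mulNr opprB.
Qed.

Lemma green u v : \sum_x m x * (u x * Delta v x) = - dirichlet u v.
Proof.
pose S := \sum_x \sum_y u x * (v y - v x) * w x y.
have -> : \sum_x m x * (u x * Delta v x) = S.
  apply: eq_bigr => x _; rewrite mulrCA measure_laplacian mulr_sumr.
  by apply: eq_bigr => y _; rewrite mulrA.
(* Exchanging [x] and [y] flips the sign of [v y - v x]; averaging the two expressions for [S]
   produces the product of differences. *)
have S' : S = - \sum_x \sum_y u y * (v y - v x) * w x y.
  rewrite /S exchange_big -sumrN; apply: eq_bigr => x _.
  rewrite -sumrN; apply: eq_bigr => y _; rewrite wg_w_sym; ring.
rewrite /dirichlet (_ : \sum_x _ = - S - S); first by field.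
rewrite {1}S' opprK /S -sumrB; apply: eq_bigr => x _.
by rewrite -sumrB; apply: eq_bigr => y _; ring.
Qed.

Lemma dirichletC u v : dirichlet u v = dirichlet v u.
Proof.
congr (_ / _); apply: eq_bigr => x _; apply: eq_bigr => y _.
by rewrite (mulrC (u y - _)).
Qed.

Lemma dirichlet_ge0 u : 0 <= dirichlet u u.
Proof.
rewrite divr_ge0 //; do 2![apply: sumr_ge0 => ? _].
by rewrite mulr_ge0 ?wg_w_ge0 // -expr2 sqr_ge0.
Qed.

(** Every term of the energy is nonnegative, so [u] agrees across each edge, and connectedness
    propagates this along paths. *)
Lemma dirichlet_eq0 u : dirichlet u u = 0 -> forall x y, u x = u y.
Proof.
move=> D0 x y.
have adj_eq a b : wg_adj G a b -> u a = u b.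
  move=> ab.
  have t_ge0 c d : 0 <= (u d - u c) * (u d - u c) * w c d.
    by rewrite mulr_ge0 ?wg_w_ge0 // -expr2 sqr_ge0.
  have s_ge0 c : 0 <= \sum_d (u d - u c) * (u d - u c) * w c d.
    exact: sumr_ge0.
  have /eqP := D0.
  rewrite mulf_eq0 invr_eq0 pnatr_eq0 orbF psumr_eq0 //.
  move=> /allP/(_ a (mem_index_enum a)).
  rewrite /= psumr_eq0 // => /allP/(_ b (mem_index_enum b)) /=.
  by rewrite !mulf_eq0 orbb subr_eq0 (gt_eqF (wg_w_gt0 ab)) orbF => /eqP.
have /connectP[p] := wg_connected G x y.
by elim: p x => [x _ -> //|z p IH x /= /andP[/adj_eq-> /IH IHz] /IHz].
Qed.

Lemma laplacian_sum (I : finType) (c : I -> R) (U : I -> V -> R) x :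
  Delta (fun y => \sum_i c i * U i y) x = \sum_i c i * Delta (U i) x.
Proof.
rewrite /laplacian; under [RHS]eq_bigr do rewrite mulrCA mulr_sumr.
rewrite -mulr_sumr exchange_big /=; congr (_ * _); apply: eq_bigr => y _.
rewrite -sumrB mulr_suml; apply: eq_bigr => i _; ring.
Qed.

Lemma sum_measure_laplacian u : \sum_x m x * Delta u x = 0.
Proof.
have := green (fun=> 1) u; under eq_bigr do rewrite mul1r.
move=> ->; rewrite /dirichlet big1 ?mul0r ?oppr0 // => x _.
by rewrite big1 // => y _; rewrite subrr !mul0r.
Qed.

Lemma sum_measure_Gamma u v : \sum_x m x * Gamma G u v x = dirichlet u v.
Proof.
have E x : m x * Gamma G u v x = 2^-1 * (m x * Delta (fun y => u y * v y) x)
    - 2^-1 * (m x * (u x * Delta v x)) - 2^-1 * (m x * (v x * Delta u x)).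
  by rewrite /Gamma; ring.
rewrite (eq_bigr _ (fun x _ => E x)) !sumrB -!mulr_sumr sum_measure_laplacian.
by rewrite !green (dirichletC v); field.
Qed.

Lemma sum_measure_Gamma2 u :
  \sum_x m x * Gamma2 G u x = \sum_x m x * Delta u x ^+ 2.
Proof.
rewrite /Gamma2.
under eq_bigr => x _ do rewrite mulrBr mulrCA.
rewrite sumrB -mulr_sumr sum_measure_laplacian mulr0 sub0r sum_measure_Gamma.
by rewrite dirichletC -green; apply: eq_bigr => x _; rewrite expr2.
Qed.

Lemma integrated_CD K n u : bakry_emery_CD G K n ->
  n^-1 * (\sum_x m x * Delta u x ^+ 2) + K * dirichlet u u
    <= \sum_x m x * Delta u x ^+ 2.
Proof.
move=> CD; rewrite -sum_measure_Gamma2 -sum_measure_Gamma.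
(* Unfolding, distributing the scalars and folding back leaves [Gamma2] on the right-hand side only,
   so that CD applies vertex by vertex. *)
rewrite sum_measure_Gamma2 !mulr_sumr -sum_measure_Gamma2 -big_split /=.
apply: ler_sum => x _; rewrite mulrCA [K * _]mulrCA -mulrDr.
by rewrite ler_pM2l ?wg_m_gt0 ?CD.
Qed.

End Energy.

(** * Harmonic extensions and the Dirichlet-to-Neumann matrix *)

Section Steklov.
Variables (R : realType) (V : finType) (G : weighted_graph R V) (B : {set V}).
Hypothesis hB : is_boundary G B.

Local Notation m := (wg_m G).
Local Notation Delta := (laplacian G).
Local Notation N := #|bdry B|.
Local Notation A := (DtN_mx G B).
Local Notation bd := (fun i : 'I_N => val (enum_val i) : V).
Local Notation indicator j := [ffun x : bdry B => (x == enum_val j)%:R].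
Local Notation ext := (fun j : 'I_N => harmonic_ext G (indicator j)).

(** At each vertex [u] or [Delta u] vanishes, so by Green's formula the energy is 0 and [u] is
    constant; [B] is nonempty. *)
Lemma harmonic_eq0 (u : V -> R) :
    (forall x, x \in B -> u x = 0) -> (forall x, x \notin B -> Delta u x = 0) ->
  forall x, u x = 0.
Proof.
move=> uB uO x.
have D0 : dirichlet G u u = 0.
  rewrite -[LHS]opprK -green big1 ?oppr0 // => y _.
  by have [/uB->|/uO->] := boolP (y \in B); rewrite ?(mul0r, mulr0).
have /set0Pn[b bB] := boundary_neq0 hB.
by rewrite (dirichlet_eq0 D0 x b) uB.
Qed.

Lemma harmonic_ext_exists (f : {ffun bdry B -> R}) :
  exists u, is_harmonic_ext G f u.
Proof.
(* The extension solves a square linear system, whose kernel vanishes by the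
   uniqueness of the solution. *)
pose delta (i : 'I_#|V|) (x : V) : R := (x == enum_val i)%:R.
(* Column [j] is the equation at the vertex [enum_val j]: a prescribed value on [B], harmonicity
   elsewhere. *)
pose M : 'M[R]_#|V| := \matrix_(i, j)
  if enum_val j \in B then delta i (enum_val j)
  else Delta (delta i) (enum_val j).
pose fn (v : 'rV[R]_#|V|) (x : V) := \sum_i v 0 i * delta i x.
have fnE v x : fn v x = v 0 (enum_rank x).
  rewrite /fn (bigD1 (enum_rank x)) //= big1 => [|i ni].
    by rewrite /delta enum_rankK eqxx mulr1 addr0.
  by rewrite /delta (_ : x == _ = false) ?mulr0 //;
    apply: contraNF ni => /eqP->; rewrite enum_valK.
have ME v x :
    (v *m M) 0 (enum_rank x) = if x \in B then fn v x else Delta (fn v) x.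
  rewrite mxE; under eq_bigr do rewrite mxE enum_rankK.
  by case: ifP => // _; rewrite laplacian_sum.
have Mu : M \in unitmx.
  rewrite -row_free_unit; apply: inj_row_free => v vM.
  apply/rowP => i; rewrite !mxE -(enum_valK i) -fnE.
  apply: harmonic_eq0 => x xB; have := ME v x; rewrite vM mxE.
    by rewrite xB.
  by rewrite (negPf xB).
(* The default 0 is the Laplacian required at interior vertices. *)
pose t := \row_(i < #|V|) (if insub (enum_val i) is Some b then f b else 0).
pose v := t *m invmx M.
exists [ffun x => fn v x].
have vM : v *m M = t by rewrite mulmxKV.
rewrite /is_harmonic_ext (_ : ([ffun x => fn v x] : V -> R) = fn v);
  last by apply/funext => x; rewrite ffunE.
split=> [b|x xB].
  by have := ME v (val b); rewrite vM mxE enum_rankK valK (valP b).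
by have := ME v x; rewrite vM mxE enum_rankK insubN // (negPf xB).
Qed.

Lemma harmonic_extP (f : {ffun bdry B -> R}) :
  is_harmonic_ext G f (harmonic_ext G f).
Proof. exact: (xgetPex 0 (harmonic_ext_exists f)). Qed.

Lemma ext_bd j i : ext j (bd i) = (i == j)%:R.
Proof.
have [-> _] := harmonic_extP (indicator j).
by rewrite ffunE (inj_eq enum_val_inj).
Qed.

Lemma laplacian_ext_interior j x : x \notin B -> Delta (ext j) x = 0.
Proof. by case: (harmonic_extP (indicator j)) => _; apply. Qed.

Lemma DtN_mxE i j : A i j = - Delta (ext j) (bd i).
Proof. by rewrite mxE ffunE normal_derivE. Qed.

Lemma bdP x : x \in B -> exists i, x = bd i.
Proof. by move=> xB; exists (enum_rank (Sub x xB)); rewrite enum_rankK. Qed.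

(** Both sides are the symmetric Dirichlet form of two basis extensions: in Green's formula only one
    boundary vertex contributes, as [ext k] vanishes at the others and [ext l] is harmonic
    inside. *)
Lemma DtN_mx_selfadjoint i j : m (bd i) * A i j = m (bd j) * A j i.
Proof.
have E k l : m (bd k) * A k l = dirichlet G (ext k) (ext l).
  rewrite -[RHS]opprK -green (bigD1 (bd k)) //= big1 => [|x xk].
    by rewrite ext_bd eqxx mul1r addr0 DtN_mxE mulrN.
  have [/bdP[i' xE]|xB] := boolP (x \in B); last first.
    by rewrite laplacian_ext_interior // !mulr0.
  rewrite xE ext_bd (_ : _ == _ = false) ?(mul0r, mulr0) //.
  by apply: contraNF xk => /eqP <-; rewrite xE.
by rewrite !E dirichletC.
Qed.

(** Here [v] is a left eigenvector, while [A] represents the operator on columns. By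
    self-adjointness, dividing by the measure gives an eigenfunction, and [u] is its harmonic
    extension. *)
Lemma eigenvector_function (a : R) (v : 'rV_N) : v *m A = a *: v ->
  exists u : V -> R, [/\ forall i, u (bd i) = v 0 i / m (bd i),
    forall x, x \in B -> Delta u x = - (a * u x) &
    forall x, x \notin B -> Delta u x = 0].
Proof.
move=> vA; have m_neq0 x : m x != 0 by rewrite gt_eqF ?wg_m_gt0.
pose c j := v 0 j / m (bd j).
exists (fun x => \sum_j c j * ext j x).
have uE i : \sum_j c j * ext j (bd i) = c i.
  rewrite (bigD1 i) //= big1 => [|j /negPf ji].
    by rewrite ext_bd eqxx mulr1 addr0.
  by rewrite ext_bd eq_sym ji mulr0.
split=> // x xB; rewrite laplacian_sum; last first.
  by rewrite big1 // => j _; rewrite laplacian_ext_interior // mulr0.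
have [i ->] := bdP xB; rewrite uE.
have /rowP/(_ i) := vA; rewrite !mxE => vAi.
rewrite /c mulrA -vAi mulr_suml -sumrN; apply: eq_bigr => j _.
rewrite -[Delta _ _]opprK -DtN_mxE mulrN; congr (- _).
apply: (mulIf (m_neq0 (bd i))); rewrite divfK // -mulrA [A i j * _]mulrC.
by rewrite DtN_mx_selfadjoint mulrA divfK.
Qed.

Lemma sum_boundary (F : V -> R) :
    (forall x, x \notin B -> F x = 0) ->
  \sum_x m x * F x = \sum_(x in B) m x * F x.
Proof.
move=> F0; rewrite [RHS]big_mkcond; apply: eq_bigr => x _.
by case: ifPn => // /F0->; rewrite mulr0.
Qed.

Lemma dirichlet_eigen (u : V -> R) a :
    (forall x, x \in B -> Delta u x = - (a * u x)) ->
    (forall x, x \notin B -> Delta u x = 0) ->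
  dirichlet G u u = a * \sum_(x in B) m x * u x ^+ 2.
Proof.
move=> uB uO.
rewrite -[LHS]opprK -green sum_boundary => [|x /uO->]; last exact: mulr0.
rewrite -sumrN mulr_sumr; apply: eq_bigr => x xB; rewrite uB //; ring.
Qed.

(* The kernel consists of the multiples of the measure: for the row vector [v]
   the eigenfunction is [v / m]. *)
Lemma DtN_mx_rank : (N.-1 <= \rank A)%N.
Proof.
have : (kermx A <= \row_i m (bd i))%MS.
  apply/rV_subP => v /sub_kermxP vA.
  have [|u [ub uB uO]] := @eigenvector_function 0 v; first by rewrite scale0r.
  have := dirichlet_eigen uB uO; rewrite mul0r => /dirichlet_eq0 uc.
  have /set0Pn[b bB] := boundary_neq0 hB.
  apply/sub_rVP; exists (u b); apply/rowP => i.
  by rewrite !mxE (uc b (bd i)) ub divfK // gt_eqF // wg_m_gt0.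
(* A single row has rank at most 1, hence so does the kernel; rank-nullity concludes. *)
move=> /mxrankS; rewrite mxrank_ker => /leq_trans/(_ (rank_leq_row _)).
by rewrite leq_subLR -subn1 leq_subLR addnC.
Qed.

Lemma DtN_mx_eigenvalue_bound K n a : 0 < K -> 1 < n -> bakry_emery_CD G K n ->
  root (char_poly A) a -> a != 0 -> n * K / (n - 1) <= a.
Proof.
move=> K_gt0 n_gt1 CD; rewrite -eigenvalue_root_char.
move=> /eigenvalueP[v vA v_neq0] a_neq0.
have [u [ub uB uO]] := eigenvector_function vA.
have DE := dirichlet_eigen uB uO.
set q := \sum_(x in B) m x * u x ^+ 2 in DE.
have q_gt0 : 0 < q.
  have [i vi] : exists i, v 0 i != 0.
    apply/existsP; apply: contraNT v_neq0 => /existsPn v0.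
    by apply/eqP/rowP => i; rewrite mxE; apply/eqP; have := v0 i; rewrite negbK.
  rewrite /q (bigD1 (bd i)) ?(valP (enum_val i)) //=.
  apply: ltr_pwDl; last first.
    by apply: sumr_ge0 => x _; rewrite mulr_ge0 ?sqr_ge0 ?ltW ?wg_m_gt0.
  rewrite mulr_gt0 ?wg_m_gt0 // exprn_even_gt0 //= ub mulf_neq0 //.
  by rewrite invr_eq0 gt_eqF ?wg_m_gt0.
(* The product [a * q] is a Dirichlet energy, hence nonnegative. *)
have a_gt0 : 0 < a.
  rewrite lt_def a_neq0 -(pmulr_lge0 _ q_gt0) -DE.
  exact: dirichlet_ge0.
have := integrated_CD u CD.
rewrite DE sum_boundary => [|x /uO->]; last by rewrite expr0n.
have -> : \sum_(x in B) m x * Delta u x ^+ 2 = a ^+ 2 * q.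
  by rewrite mulr_sumr; apply: eq_bigr => x /uB->; ring.
have n_gt0 : 0 < n by apply: lt_trans n_gt1.
(* Cancelling the positive factor [a * q] leaves the linear inequality [a / n + K <= a]. *)
have -> : n^-1 * (a ^+ 2 * q) + K * (a * q) = (a / n + K) * (a * q) by ring.
have -> : a ^+ 2 * q = a * (a * q) by ring.
rewrite ler_pM2r ?mulr_gt0 // => h.
rewrite ler_pdivrMr ?subr_gt0 //.
have := h; rewrite -(ler_pM2r n_gt0) mulrDl divfK ?gt_eqF //; lra.
Qed.

End Steklov.

(** * Locating the second entry of the sorted spectrum *)

Theorem corollary1p4 (R : realType) (V : finType) (G : weighted_graph R V)
    (B : {set V}) (K n : R)
    (hB : is_boundary G B)
    (hcard : (2 <= #|B|)%N)
    (hK : 0 < K)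
    (hn : 1 < n)
    (hCD : bakry_emery_CD G K n) :
  n * K / (n - 1) <= steklov_eigenvalue G B 2.
Proof.
have c_gt0 : 0 < n * K / (n - 1).
  by rewrite divr_gt0 ?mulr_gt0 ?subr_gt0 // (lt_trans _ hn).
have [rs pE rk] :=
  selfadjoint_spectrum (fun i => wg_m_gt0 G _) (DtN_mx_selfadjoint hB).
have bound r : r \in rs -> r != 0 -> n * K / (n - 1) <= r.
  move=> r_rs; apply: (DtN_mx_eigenvalue_bound hB hK hn hCD).
  by rewrite pE root_prod_XsubC.
have cardE : #|bdry B| = #|B| by rewrite card_sig; apply: eq_card.
have size_rs : size rs = #|B|.
  have := size_char_poly (DtN_mx G B).
  by rewrite pE size_prod_XsubC cardE => -[].
(* At least [#|B| - 1] of the [#|B|] roots are nonzero, by the two rank bounds. *)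
have rs0 : (count_mem 0%R rs <= 1)%N.
  have := leq_trans (DtN_mx_rank hB) rk; rewrite cardE -size_rs.
  rewrite -(count_predC (pred1 0%R) rs) -subn1 leq_subLR.
  by rewrite leq_add2r.
have perm_s : perm_eq (steklov_spectrum G B) rs.
  by rewrite /steklov_spectrum pE perm_flatten_mup_rootsR.
rewrite /steklov_eigenvalue.
have s_le : sorted <=%R (steklov_spectrum G B).
  by apply: sorted_flatten_nseq; exact: sorted_roots.
move: s_le perm_s.
(* Numbering starts from 1, so the eigenvalue in question is [b]; [hcard] excludes shorter lists. *)
case: (steklov_spectrum G B) => [|a [|b s]] /= s_le perm_s.
- by move: hcard; rewrite -size_rs -(perm_size perm_s).
- by move: hcard; rewrite -size_rs -(perm_size perm_s).
have a_le_b : a <= b by case/andP: s_le.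
have [b0|b_neq0] := eqVneq b 0; last first.
  by apply: bound => //; rewrite -(perm_mem perm_s) !inE eqxx orbT.
(* A nonzero [a] would be at least the positive bound, contradicting [a <= b = 0]. So [b = 0] would
   make 0 a double root, against [rs0]. *)
have a0 : a = 0.
  apply: contraTeq a_le_b => a_neq0; rewrite b0 -ltNge (lt_le_trans c_gt0) //.
  by apply: bound => //; rewrite -(perm_mem perm_s) mem_head.
by move: rs0; rewrite -(permP perm_s) /= a0 b0 eqxx.
Qed.
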